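(* Let $\mathcal M$, $\mathcal M^{\uparrow}$ and $\mathcal M_{\downarrow}$ be the potential solution region, the outer approximation and the inner approximation defined in the context. Then $\partial\mathcal M=\partial\mathcal M^{\uparrow}=\partial\mathcal M_{\downarrow}$.
   Context: Fix a positive integer $n$, real numbers $r,\sigma_1,\sigma_2,L>0$, and $\mathbf x_1^*=(-r,0,\dots,0)$, $\mathbf x_2^*=(r,0,\dots,0)\in\mathbb R^n$. $\|\cdot\|$ is the Euclidean norm, and $\partial\mathcal E=\overline{\mathcal E}\setminus\mathcal E^\circ$ is the boundary in $\mathbb R^n$. For $\mathbf x^*\in\mathbb R^n$ and $\sigma>0$, $\mathcal S(\mathbf x^*,\sigma)$ is the set of all differentiable functions $f:\mathbb R^n\to\mathbb R$ that are $\sigma$-strongly convex, i.e. $\langle\nabla f(\mathbf x)-\nabla f(\mathbf y),\mathbf x-\mathbf y\rangle\ge\sigma\|\mathbf x-\mathbf y\|^2$ for all $\mathbf x,\mathbf y$, and have their minimizer at $\mathbf x^*$. The potential solution region is $$\mathcal M=\{\mathbf x\in\mathbb R^n:\exists f_1\in\mathcal S(\mathbf x_1^*,\sigma_1),\ \exists f_2\in\mathcal S(\mathbf x_2^*,\sigma_2),\ \nabla f_1(\mathbf x)=-\nabla f_2(\mathbf x),\ \|\nabla f_1(\mathbf x)\|=\|\nabla f_2(\mathbf x)\|\le L\}.$$ $\angle(\mathbf u,\mathbf v)=\arccos\frac{\langle\mathbf u,\mathbf v\rangle}{\|\mathbf u\|\|\mathbf v\|}\in[0,\pi]$ for nonzero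 $\mathbf u,\mathbf v$. For $i\in\{1,2\}$: $\mathcal B_i=\{\mathbf x\in\mathbb R^n:\|\mathbf x-\mathbf x_i^*\|<L/\sigma_i\}$; $\tilde\phi_i(\mathbf x)=\arccos\big(\frac{\sigma_i}{L}\|\mathbf x-\mathbf x_i^*\|\big)$ for $\mathbf x\in\overline{\mathcal B}_i$; $\alpha_i(\mathbf x)=\angle(\mathbf x-\mathbf x_i^*,\mathbf x_2^*-\mathbf x_1^* )$ for $\mathbf x\ne\mathbf x_i^*$. For $\mathbf x\notin\{\mathbf x_1^*,\mathbf x_2^*\}$, $\psi(\mathbf x)=\pi-(\alpha_2(\mathbf x)-\alpha_1(\mathbf x))$. Let $\mathcal X=\{\mathbf x\in\mathbb R^n:\|\mathbf x-\mathbf x_i^*\|=L/\sigma_i\text{ for }i=1,2\}$ if $\|\mathbf x_2^*-\mathbf x_1^*\|=L\big(\frac1{\sigma_1}+\frac1{\sigma_2}\big)$, and $\mathcal X=\emptyset$ otherwise. Then $$\mathcal M^{\uparrow}=\{\mathbf x\in\mathbb R^n:\tilde\phi_1(\mathbf x)+\tilde\phi_2(\mathbf x)\ge\psi(\mathbf x)\},\qquad \mathcal M_{\downarrow}=\{\mathbf x\in\mathbb R^n:\tilde\phi_1(\mathbf x)+\tilde\phi_2(\mathbf x)>\psi(\mathbf x)\}\cup\mathcal X,$$ where in the inequalities $\mathbf x$ is implicitly required to lie in the common domain $(\overline{\mathcal B}_1\cap\overline{\mathcal B}_2)\setminus\{\mathbf x_1^*,\mathbf x_2^*\}$ of $\tilde\phi_1,\tilde\phi_2,\psi$.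 *)

(* Defs.v *)
From HB Require Import structures.
From mathcomp Require Import all_boot all_order all_algebra.
From mathcomp Require Import all_classical all_reals all_analysis.

Set Implicit Arguments.
Unset Strict Implicit.
Unset Printing Implicit Defensive.

Import Order.TTheory GRing.Theory Num.Theory.
Import numFieldNormedType.Exports.

Local Open Scope classical_set_scope.
Local Open Scope ring_scope.

(* R^n is 'rV[R]_n.  The library norm `|x| on 'rV[R]_n is the sup norm, so the
   Euclidean inner product and norm are defined here.  Closure, interior and
   differentiability are the library's notions on 'rV[R]_n; they do not depend
   on which of these two equivalent norms is used. *)
Section Euclidean.
Context {R : realType} {n : nat}.
Implicit Types (u v x : 'rV[R]_n) (A : set 'rV[R]_n) (f : 'rV[R]_n -> R).

Definition dotp u v : R := \sum_(i < n) u 0 i * v 0 i.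

Definition enorm u : R := Num.sqrt (dotp u u).

(* Meaningful only for u and v nonzero. *)
Definition angle u v : R := acos (dotp u v / (enorm u * enorm v)).

Definition boundary A : set 'rV[R]_n := closure A `\` interior A.

(* Row vector of partial derivatives; used only for differentiable f. *)
Definition gradient f x : 'rV[R]_n := \row_(i < n) 'D_(delta_mx 0 i) f x.

Definition strongly_convex (sigma : R) f :=
  forall x y,
    dotp (gradient f x - gradient f y) (x - y) >= sigma * enorm (x - y) ^+ 2.

Definition is_minimizer f x := forall y, f x <= f y.

(* The class S(c, sigma). *)
Definition sc_class (c : 'rV[R]_n) (sigma : R) : set ('rV[R]_n -> R) :=
  [set f | [/\ forall x, differentiable f x,
               strongly_convex sigma f
             & is_minimizer f c]].

End Euclidean.

(* The point (a, 0, ..., 0) of R^n, for n > 0. *)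
Definition axis_point {R : realType} (n : nat) (a : R) : 'rV[R]_n :=
  \row_(i < n) (if nat_of_ord i == 0%N then a else 0).

Section Regions.
Context {R : realType} {n : nat}.
(* xs1, xs2 are the minimizers x_1^*, x_2^*. *)
Variables (xs1 xs2 : 'rV[R]_n) (sigma1 sigma2 L : R).
Implicit Types x c : 'rV[R]_n.

(* The potential solution region M. *)
Definition solution_region : set 'rV[R]_n :=
  [set x | exists f1 f2 : 'rV[R]_n -> R,
    [/\ sc_class xs1 sigma1 f1,
        sc_class xs2 sigma2 f2,
        gradient f1 x = - gradient f2 x,
        enorm (gradient f1 x) = enorm (gradient f2 x)
      & enorm (gradient f2 x) <= L]].

Definition eball c (rho : R) : set 'rV[R]_n := [set x | enorm (x - c) < rho].

(* tphi xs_i sigma_i is the function written \tilde\phi_i; meaningful only on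
   the closure of eball xs_i (L / sigma_i). *)
Definition tphi c (sigma : R) x : R := acos (sigma / L * enorm (x - c)).

(* alpha xs_i is the function alpha_i; meaningful only for x != xs_i. *)
Definition alpha c x : R := angle (x - c) (xs2 - xs1).

Definition psi x : R := pi - (alpha xs2 x - alpha xs1 x).

(* The common domain of tphi xs1 sigma1, tphi xs2 sigma2 and psi. *)
Definition angle_domain : set 'rV[R]_n :=
  (closure (eball xs1 (L / sigma1)) `&` closure (eball xs2 (L / sigma2)))
    `\` [set xs1; xs2].

(* The exceptional set, called X in the mathematical definition of the inner
   approximation: nonempty only when the two balls are externally tangent. *)
Definition tangency_set : set 'rV[R]_n :=
  if enorm (xs2 - xs1) == L * (sigma1^-1 + sigma2^-1)
  then [set x | enorm (x - xs1) = L / sigma1 /\ enorm (x - xs2) = L / sigma2]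
  else set0.

Definition outer_approx : set 'rV[R]_n :=
  [set x | angle_domain x /\ tphi xs1 sigma1 x + tphi xs2 sigma2 x >= psi x].

Definition inner_approx : set 'rV[R]_n :=
  [set x | angle_domain x /\ tphi xs1 sigma1 x + tphi xs2 sigma2 x > psi x]
  `|` tangency_set.

End Regions.

(* Main.v *)
Require Import Defs.
From mathcomp Require Import all_boot all_order all_algebra.
From mathcomp Require Import all_classical all_reals all_analysis.
From mathcomp Require Import ring lra.
Import Order.TTheory GRing.Theory Num.Theory.
Import numFieldNormedType.Exports.
Local Open Scope classical_set_scope.
Local Open Scope ring_scope.
Set Implicit Arguments.
Unset Strict Implicit.
Unset Printing Implicit Defensive.

(** Write d_i = |x - xs_i| and D = |xs2 - xs1|.

    A vector g is the gradient at x of a member of the class of c and sigma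
    exactly when w = g - sigma (x - c) vanishes or satisfies <w, x - c> > 0: a
    quadratic with Hessian sigma I + w w^T / <w, x - c> realizes it.  So x lies
    in the solution region iff some g with |g| <= L makes an angle at most
    tphi_1 with x - xs1 and at most tphi_2 with xs2 - x, with a mild strictness
    condition on the extreme angles.  Since the angles of a triangle add up to
    pi, psi(x) is the angle between x - xs1 and xs2 - x [psiE]; the triangle
    inequality for angles then gives
    solution region <= outer approximation [solution_region_outer], and
    interpolating between the two directions gives
    inner approximation <= solution region [inner_solution_region].

    It remains to see that the inner and outer approximations, which sandwich
    the solution region, have the same closure and the same interior
    [boundary_sandwich].  They differ only at critical points, where
    tphi_1 + tphi_2 = psi and the balls are not tangent.  Such a point is off
    the line through xs1 and xs2 [critical_not_aligned].  The angles of the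
    triangle x, xs1, xs2 at xs1 and xs2 cannot both be obtuse or right, so by
    symmetry the one at xs2 is acute, that is d_1^2 < d_2^2 + D^2.  Rotate x
    about xs1.  This fixes d_1 and tphi_1 while d_2 moves in both directions;
    as d_2 decreases tphi_2 strictly increases and, by acuteness, psi does not
    increase [psi_le].  Hence rotating one way enters the inner approximation
    and rotating the other way leaves the outer one [perturb_acute]. *)

(** * Euclidean inner product, norm and balls *)

Section InnerProduct.
Context {R : realType} {n : nat}.
Implicit Types (u v w x c : 'rV[R]_n) (k : R).

Lemma dotpC u v : dotp u v = dotp v u.
Proof. by apply: eq_bigr => i _; rewrite mulrC. Qed.

Lemma dotpDl u v w : dotp (u + v) w = dotp u w + dotp v w.
Proof. by rewrite -big_split; apply: eq_bigr => i _; rewrite mxE mulrDl. Qed.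

Lemma dotpZl k u w : dotp (k *: u) w = k * dotp u w.
Proof. by rewrite /dotp mulr_sumr; apply: eq_bigr => i _; rewrite mxE mulrA. Qed.

Lemma dotpNl u w : dotp (- u) w = - dotp u w.
Proof. by rewrite -scaleN1r dotpZl mulN1r. Qed.

Lemma dotpBl u v w : dotp (u - v) w = dotp u w - dotp v w.
Proof. by rewrite dotpDl dotpNl. Qed.

Lemma dotpDr u v w : dotp w (u + v) = dotp w u + dotp w v.
Proof. by rewrite dotpC dotpDl !(dotpC w). Qed.

Lemma dotpZr k u w : dotp w (k *: u) = k * dotp w u.
Proof. by rewrite dotpC dotpZl !(dotpC w). Qed.

Lemma dotpNr u w : dotp w (- u) = - dotp w u.
Proof. by rewrite dotpC dotpNl !(dotpC w). Qed.

Lemma dotpBr u v w : dotp w (u - v) = dotp w u - dotp w v.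
Proof. by rewrite dotpC dotpBl !(dotpC w). Qed.

Definition dotpE := (dotpDl, dotpNl, dotpZl, dotpDr, dotpNr, dotpZr).

Lemma dotp_ge0 u : 0 <= dotp u u.
Proof. by apply: sumr_ge0 => i _; rewrite -expr2 sqr_ge0. Qed.

Lemma dotp_eq0 u : (dotp u u == 0) = (u == 0).
Proof.
apply/eqP/eqP => [u0|->]; last by rewrite /dotp big1// => i _; rewrite mxE mul0r.
apply/rowP => i; rewrite mxE; apply/eqP; rewrite -sqrf_eq0 expr2; apply/eqP.
by apply: (psumr_eq0P _ u0) => // j _; rewrite -expr2 sqr_ge0.
Qed.

Lemma dotp_gt0 u : (0 < dotp u u) = (u != 0).
Proof. by rewrite lt0r dotp_ge0 andbT dotp_eq0. Qed.

Lemma enorm_ge0 u : 0 <= enorm u.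
Proof. exact: sqrtr_ge0. Qed.

Lemma enorm_sqr u : enorm u ^+ 2 = dotp u u.
Proof. by rewrite sqr_sqrtr// dotp_ge0. Qed.

Lemma enorm_gt0 u : (0 < enorm u) = (u != 0).
Proof. by rewrite sqrtr_gt0 dotp_gt0. Qed.

Lemma enormN u : enorm (- u) = enorm u.
Proof. by rewrite /enorm dotpNl dotpNr opprK. Qed.

Lemma enormB u v : enorm (u - v) = enorm (v - u).
Proof. by rewrite -enormN opprB. Qed.

Lemma enormZ k u : enorm (k *: u) = `|k| * enorm u.
Proof.
by rewrite /enorm dotpZl dotpZr mulrA -expr2 sqrtrM ?sqr_ge0// sqrtr_sqr.
Qed.

Lemma dotp_sqr_le u v : dotp u v ^+ 2 <= dotp u u * dotp v v.
Proof.
have [->|v0] := eqVneq v 0.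
  by rewrite -{1}(scale0r 0) dotpZr mul0r expr0n mulr_ge0 ?dotp_ge0.
have v1 : 0 < dotp v v by rewrite dotp_gt0.
have := dotp_ge0 (dotp v v *: u - dotp u v *: v).
rewrite !dotpE (dotpC v u).
set a := dotp u u; set b := dotp u v; set c := dotp v v => h.
have {}h : 0 <= c * (a * c - b ^+ 2).
  by rewrite (le_trans h)// le_eqVlt; apply/orP; left; apply/eqP; ring.
by move: h; rewrite pmulr_rge0// subr_ge0.
Qed.

Lemma dotp_le_enorm u v : `|dotp u v| <= enorm u * enorm v.
Proof.
rewrite -(@ler_pXn2r _ 2)// ?nnegrE ?mulr_ge0 ?enorm_ge0//.
by rewrite real_normK ?num_real// exprMn !enorm_sqr dotp_sqr_le.
Qed.

Lemma dotp_le u v : dotp u v <= enorm u * enorm v.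
Proof. exact: le_trans (ler_norm _) (dotp_le_enorm u v). Qed.

Lemma cosine_itv u v : -1 <= dotp u v / (enorm u * enorm v) <= 1.
Proof.
rewrite -ler_norml normrM normfV.
rewrite [`|_ * enorm _|]ger0_norm ?mulr_ge0 ?enorm_ge0//.
have [->|h] := eqVneq (enorm u * enorm v) 0; first by rewrite invr0 mulr0 ler01.
by rewrite ler_pdivrMr ?mul1r ?dotp_le_enorm// lt_neqAle eq_sym h mulr_ge0 ?enorm_ge0.
Qed.

Lemma continuous_dotp (T : topologicalType) (f g : T -> 'rV[R]_n) :
  continuous f -> continuous g -> continuous (fun t => dotp (f t) (g t)).
Proof.
move=> cf cg t; apply: cvg_big => [|i _]; first exact: add_continuous.
apply: cvgM.
  apply: (@continuous_comp _ _ _ f (fun M : 'rV[R]_n => M 0 i) t (cf t)).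
  exact: coord_continuous.
apply: (@continuous_comp _ _ _ g (fun M : 'rV[R]_n => M 0 i) t (cg t)).
exact: coord_continuous.
Qed.

Lemma continuous_enorm_sub c : continuous (fun x => enorm (x - c)).
Proof.
have h : continuous (fun x : 'rV[R]_n => x - c).
  move=> x; apply: (@continuousB _ _ _ id (cst c)); first exact: cvg_id.
  exact: cst_continuous.
move=> x; apply: (@continuous_comp _ _ _ (fun x => dotp (x - c) (x - c)) Num.sqrt).
  exact: continuous_dotp.
exact: sqrt_continuous.
Qed.

(** A point on the sphere is the limit of the points
    [c + t (x - c)] as [t] tends to 1 from below. *)
Lemma closure_eball c (rho : R) : 0 < rho ->
  closure (eball c rho) = [set x | enorm (x - c) <= rho].
Proof.
move=> rho0; apply/seteqP; split.
  have cl : closed [set x | enorm (x - c) <= rho].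
    apply: (preimage_closed (f := fun x => enorm (x - c)) (D := [set t | t <= rho])).
      by move=> x _; exact: continuous_enorm_sub.
    exact: closed_le.
  rewrite [X in _ `<=` X](closure_id _).1//; apply: closureS => x /=.
  exact: ltW.
move=> x /= xr B Bx.
pose g (t : R) : 'rV[R]_n := c + t *: (x - c).
have gc : continuous g.
  move=> t; apply: cvgD; first exact: cvg_cst.
  by apply: (@cvgZr_tmp _ _ _ _ _ id); exact: cvg_id.
have g1 : g 1 = x by rewrite /g scale1r addrC subrK.
have := gc 1; rewrite /continuous_at g1 => /(_ B Bx).
rewrite /nbhs/= => /nbhs_ballP [e /= e0 he].
pose s := Num.min (e / 2) 1.
have s0 : 0 < s by rewrite lt_min divr_gt0//= ltr01.
have s1 : s <= 1 by rewrite ge_min lexx orbT.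
have se : s < e by rewrite gt_min; apply/orP; left; lra.
exists (g (1 - s)); split; last first.
  by apply: he; rewrite /ball/= opprB addrCA subrr addr0 gtr0_norm.
rewrite /eball/= /g addrC addKr enormZ ger0_norm ?subr_ge0//.
have := enorm_ge0 (x - c); move: (enorm _) xr => t; nra.
Qed.

End InnerProduct.

(** * Gradients of strongly convex functions at a given point *)

Section Gradients.
Context {R : realType} {n : nat}.
Implicit Types (u v w x y c g : 'rV[R]_n) (k sigma : R).

(** The function [quadratic] below has degree two along every line, so its
    directional derivatives can be read off from its values on the line. *)
Lemma derive_quadratic (f : 'rV[R]_n -> R) x v (a b : R) :
  (forall h : R, f (h *: v + x) = f x + h * a + h ^+ 2 * b) -> 'D_v f x = a.
Proof.
move=> fE; apply: cvg_lim => //.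
have : (fun h : R => a + h * b) @ 0^' --> a + 0 * b.
  apply: cvgD; first exact: cvg_cst.
  by apply: cvgMr_tmp; apply: cvg_within_filter; exact: cvg_id.
rewrite mul0r addr0; apply: cvg_trans; apply: near_eq_cvg.
near=> h.
have h0 : h != 0 by near: h; exact: nbhs_dnbhs_neq.
rewrite /= fE /GRing.scale/=; field.
Unshelve. all: by end_near. Qed.

Lemma gradient_center (f : 'rV[R]_n -> R) c sigma :
  sc_class c sigma f -> gradient f c = 0.
Proof.
move=> [df _ cmin]; apply/rowP => i; rewrite !mxE.
set v := delta_mx 0 i.
have dl (t : R) : derivable (fun h : R => f (h *: v + c)) t 1.
  apply/derivable1_diffP.
  apply: (@differentiable_comp _ _ _ _ (fun h : R => h *: v + c) f).
    by [].
  exact: df.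
have le11 : -1 <= 1 :> R by lra.
have in01 : (0 : R) \in `](-1), 1[%R by rewrite in_itv/= ltrN10 ltr01.
have [|_ <-] := derive1_at_min le11 (fun t _ => dl t) in01.
  by move=> t _; rewrite scale0r add0r; exact: cmin.
rewrite /derive; set g1 := fun h => _; set g2 := fun h => _.
suff -> : g1 = g2 by [].
by apply/funext => h; rewrite /g1 /g2 /= addr0 scale0r add0r [_ *: (1:R)]mulr1.
Qed.

(** Hessian [sigma I + k w w^T], minimum at [c]. *)
Definition quadratic c sigma k w x : R :=
  sigma / 2 * dotp (x - c) (x - c) + k / 2 * dotp w (x - c) ^+ 2.

Lemma gradient_quadratic c sigma k w x :
  gradient (quadratic c sigma k w) x
  = sigma *: (x - c) + (k * dotp w (x - c)) *: w.
Proof.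
have dotp_delta u i : dotp u (delta_mx 0 i) = u 0 i.
  rewrite /dotp (bigD1 i)//= big1 => [|j ji]; rewrite !mxE ?eqxx ?mulr1 ?addr0//.
  by rewrite (negbTE ji) andbF mulr0.
apply/rowP => i; rewrite [LHS]mxE; set v := delta_mx 0 i.
transitivity (sigma * dotp (x - c) v + k * dotp w (x - c) * dotp w v).
  apply: (@derive_quadratic _ _ _ _ (sigma / 2 * dotp v v + k / 2 * dotp w v ^+ 2)).
  move=> h; rewrite /quadratic -addrA; move: (x - c) => y; rewrite !dotpE (dotpC v y).
  by field.
by rewrite /v !dotp_delta !mxE.
Qed.

Lemma differentiable_quadratic c sigma k w x :
  differentiable (quadratic c sigma k w) x.
Proof.
have dcoord i : differentiable (fun y : 'rV[R]_n => (y - c) 0 i) x.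
  have -> : (fun y : 'rV[R]_n => (y - c) 0 i) = (fun y => y 0 i) - cst (c 0 i).
    by apply/funext => y; rewrite !mxE.
  by apply: differentiableB; [exact: differentiable_coord | exact: differentiable_cst].
have ddot (g h : 'I_n -> 'rV[R]_n -> R) : (forall i, differentiable (g i) x) ->
    (forall i, differentiable (h i) x) ->
    differentiable (fun y => \sum_(i < n) g i y * h i y) x.
  move=> dg dh.
  have -> : (fun y => \sum_(i < n) g i y * h i y) = \sum_(i < n) (g i * h i).
    by apply/funext => y; rewrite fct_sumE.
  by apply: differentiable_sum => i; exact: differentiableM.
apply: differentiableD.
  by apply: differentiableM; [exact: differentiable_cst | exact: ddot].
apply: differentiableM; first exact: differentiable_cst.
have dw : differentiable (fun y => dotp w (y - c)) x.
  by apply: ddot => // i; exact: differentiable_cst.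
exact: (differentiableM dw dw).
Qed.

(** The gradient is affine, and its linear part [z |-> sigma z + k <w, z> w]
    is at least [sigma] times the identity. *)
Lemma sc_class_quadratic c sigma k w : 0 <= sigma -> 0 <= k ->
  sc_class c sigma (quadratic c sigma k w).
Proof.
move=> s0 k0; split.
- exact: differentiable_quadratic.
- move=> x y; rewrite !gradient_quadratic enorm_sqr.
  have -> : x - y = (x - c) - (y - c) by rewrite opprB addrA subrK.
  move: (x - c) (y - c) => a b.
  have -> : sigma *: a + (k * dotp w a) *: w - (sigma *: b + (k * dotp w b) *: w)
      = sigma *: (a - b) + (k * dotp w (a - b)) *: w.
    by rewrite dotpBr mulrBr scalerBl scalerBr opprD addrACA.
  move: (a - b) => z; rewrite dotpDl !dotpZl lerDl -mulrA mulr_ge0//.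
  by rewrite -expr2 sqr_ge0.
- move=> x; rewrite {1}/quadratic subrr -(scale0r 0) !dotpZr !mul0r expr0n/= !mulr0 addr0.
  by rewrite addr_ge0// mulr_ge0 ?dotp_ge0 ?sqr_ge0 ?divr_ge0.
Qed.

(** Strong convexity between [x] and the minimizer, where the gradient
    vanishes. *)
Lemma sc_class_gradient_necessary c sigma f x : sc_class c sigma f ->
  sigma * dotp (x - c) (x - c) <= dotp (gradient f x) (x - c).
Proof.
move=> fS; have [_ /(_ x c) + _] := fS.
by rewrite (gradient_center fS) subr0 enorm_sqr.
Qed.

(** A converse of [sc_class_gradient_necessary], apart from the
    equality case, in which [g] has to be [sigma *: (x - c)].  Otherwise
    [w = g - sigma *: (x - c)] has a positive product with [x - c], and the
    rank-one term of [quadratic] can be scaled to have gradient [w] at [x]. *)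
Lemma sc_class_gradient_sufficient c sigma g x : 0 <= sigma ->
  g = sigma *: (x - c) \/ sigma * dotp (x - c) (x - c) < dotp g (x - c) ->
  exists2 f, sc_class c sigma f & gradient f x = g.
Proof.
move=> s0 [->|gx].
  exists (quadratic c sigma 0 0); first exact: sc_class_quadratic.
  by rewrite gradient_quadratic scaler0 addr0.
set w := g - sigma *: (x - c).
have wx : 0 < dotp w (x - c) by rewrite dotpBl dotpZl subr_gt0.
exists (quadratic c sigma (dotp w (x - c))^-1 w).
  by apply: sc_class_quadratic => //; rewrite invr_ge0 ltW.
by rewrite gradient_quadratic mulVf ?gt_eqF// scale1r addrC subrK.
Qed.

End Gradients.

(** * Angles between vectors *)

Section Angles.
Context {R : realType} {n : nat}.
Implicit Types (u v w h x y c g : 'rV[R]_n) (a b k s t : R).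

Lemma le_acos s t : -1 <= s <= 1 -> -1 <= t <= 1 ->
  (acos s <= acos t) = (t <= s).
Proof.
move=> hs ht; rewrite !leNgt -ltr_cos; last 2 first.
- by rewrite in_itv/= acos_ge0 ?acos_lepi.
- by rewrite in_itv/= acos_ge0 ?acos_lepi.
by rewrite !acosK// in_itv/=.
Qed.

Lemma lt_acos s t : -1 <= s <= 1 -> -1 <= t <= 1 ->
  (acos s < acos t) = (t < s).
Proof. by move=> hs ht; rewrite !ltNge le_acos. Qed.

Lemma acos_cos t : 0 <= t <= pi -> acos (cos t) = t.
Proof. by move=> ht; rewrite cosK// in_itv. Qed.

Lemma cos_angle u v : cos (angle u v) = dotp u v / (enorm u * enorm v).
Proof. by rewrite acosK// in_itv/= cosine_itv. Qed.

Lemma angle_ge0 u v : 0 <= angle u v.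
Proof. exact/acos_ge0/cosine_itv. Qed.

Lemma angle_le_pi u v : angle u v <= pi.
Proof. exact/acos_lepi/cosine_itv. Qed.

Lemma angleC u v : angle u v = angle v u.
Proof. by rewrite /angle dotpC [enorm u * _]mulrC. Qed.

Lemma angleN u v : angle u (- v) = pi - angle u v.
Proof. by rewrite /angle dotpNr enormN mulNr acosN// cosine_itv. Qed.

Definition direction u := (enorm u)^-1 *: u.

Lemma dotp_direction u v :
  dotp (direction u) (direction v) = dotp u v / (enorm u * enorm v).
Proof. by rewrite dotpZl dotpZr invfM; ring. Qed.

Lemma direction_sqr u : u != 0 -> dotp (direction u) (direction u) = 1.
Proof.
by move=> u0; rewrite dotp_direction -expr2 enorm_sqr divff// gt_eqF// dotp_gt0.
Qed.

Lemma sin_angle u v : u != 0 -> v != 0 ->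
  sin (angle u v)
  = Num.sqrt (dotp u u * dotp v v - dotp u v ^+ 2) / (enorm u * enorm v).
Proof.
move=> u0 v0; rewrite sin_acos ?cosine_itv//.
have -> : 1 - (dotp u v / (enorm u * enorm v)) ^+ 2
  = (dotp u u * dotp v v - dotp u v ^+ 2) / (enorm u * enorm v) ^+ 2.
  by rewrite -!enorm_sqr; field; rewrite !gt_eqF ?enorm_gt0.
rewrite sqrtrM ?subr_ge0 ?dotp_sqr_le// sqrtrV ?sqr_ge0// sqrtr_sqr ger0_norm//.
by rewrite mulr_ge0 ?enorm_ge0.
Qed.

(** The exterior angle theorem for the triangle with sides [u], [v] and
    [u - v].  Both sines have the numerator [sqrt (|u|^2 |v|^2 - <u, v>^2)],
    twice the area of the triangle, so that the addition formula for the
    cosine reduces to a polynomial identity. *)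
Lemma angle_sum_triangle u v : u != 0 -> v != 0 -> u != v ->
  angle v (u - v) - angle u (u - v) = angle u v.
Proof.
move=> u0 v0; rewrite -subr_eq0 => e0.
have nu : 0 < enorm u by rewrite enorm_gt0.
have nv : 0 < enorm v by rewrite enorm_gt0.
have ne : 0 < enorm (u - v) by rewrite enorm_gt0.
have ge0 : angle u (u - v) <= angle v (u - v).
  rewrite le_acos ?cosine_itv// ler_pdivrMr ?mulr_gt0// mulrAC ler_pdivlMr ?mulr_gt0//.
  rewrite !mulrA ler_pM2r//.
  rewrite -subr_ge0 !dotpBr (dotpC v u) -!enorm_sqr.
  have -> : (enorm u ^+ 2 - dotp u v) * enorm v - (dotp u v - enorm v ^+ 2) * enorm u
    = (enorm u + enorm v) * (enorm u * enorm v - dotp u v) by ring.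
  by rewrite mulr_ge0 ?subr_ge0 ?dotp_le// addr_ge0 ?enorm_ge0.
rewrite -[LHS]acos_cos ?subr_ge0 ?ge0/=; last first.
  by rewrite lerBlDr (le_trans (angle_le_pi _ _))// lerDl angle_ge0.
congr acos; rewrite cosB !cos_angle !sin_angle//.
have -> : dotp v v * dotp (u - v) (u - v) - dotp v (u - v) ^+ 2 =
  dotp u u * dotp v v - dotp u v ^+ 2.
  by rewrite !dotpE (dotpC v u); ring.
have -> : dotp u u * dotp (u - v) (u - v) - dotp u (u - v) ^+ 2 =
  dotp u u * dotp v v - dotp u v ^+ 2.
  by rewrite !dotpE (dotpC v u); ring.
rewrite !mulf_div -expr2 sqr_sqrtr ?subr_ge0 ?dotp_sqr_le// -mulrDl.
have -> : dotp v (u - v) * dotp u (u - v) + (dotp u u * dotp v v - dotp u v ^+ 2)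
  = dotp u v * enorm (u - v) ^+ 2.
  by rewrite enorm_sqr !dotpE (dotpC v u); ring.
by field; rewrite !gt_eqF.
Qed.

(** For unit vectors, this is the Cauchy-Schwarz inequality for the
    components of [u] and [w] orthogonal to [h], whose lengths are the sines of
    the two angles. *)
Lemma angle_triangle u h w : u != 0 -> h != 0 -> w != 0 ->
  angle u w <= angle u h + angle h w.
Proof.
move=> u0 h0 w0.
have [s_pi|/ltW s_pi] := lerP pi (angle u h + angle h w).
  exact: le_trans (angle_le_pi _ _) s_pi.
rewrite -[leRHS]acos_cos ?addr_ge0 ?angle_ge0// le_acos ?cosine_itv ?cos_geN1 ?cos_le1//.
rewrite cosD !cos_angle !sin_acos ?cosine_itv// -!dotp_direction.
have := direction_sqr u0; have := direction_sqr h0; have := direction_sqr w0.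
move: (direction u) (direction h) (direction w) => {u0 h0 w0 s_pi}u {}h {}w ww hh uu.
have cs := dotp_sqr_le (u - dotp u h *: h) (w - dotp h w *: h).
have le1 v : dotp v v = 1 -> 0 <= 1 - dotp v h ^+ 2.
  by move=> v1; rewrite subr_ge0; have := dotp_sqr_le v h; rewrite v1 hh mulr1.
rewrite -sqrtrM ?le1// lerBlDr addrC -lerBlDr -[leRHS]addr0.
apply: le_trans (ler_norm _) _; rewrite -sqrtr_sqr addr0.
rewrite ler_wsqrtr//; move: cs.
rewrite !dotpE (dotpC h u) (dotpC w h) uu hh ww.
by move: (dotp u h) (dotp h w) (dotp u w) => a b t; lra.
Qed.

End Angles.

(** * The angles psi and tphi *)

Section Regions.
Context {R : realType} {n : nat}.
Implicit Types (u v w h x y c g : 'rV[R]_n) (s t sigma : R).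

Lemma psiE xs1 xs2 x : xs1 != xs2 -> x != xs1 -> x != xs2 ->
  psi xs1 xs2 x = angle (x - xs1) (xs2 - x).
Proof.
move=> x12 x1 x2; rewrite /psi /alpha.
have E : (x - xs1) - (x - xs2) = xs2 - xs1 by rewrite opprB [LHS]addrC subrKA.
rewrite -E angle_sum_triangle ?subr_eq0// -?angleN ?opprB//.
by rewrite -subr_eq0 E subr_eq0 eq_sym.
Qed.

Lemma psiC xs1 xs2 x : xs1 != xs2 -> x != xs1 -> x != xs2 ->
  psi xs1 xs2 x = psi xs2 xs1 x.
Proof.
move=> x12 x1 x2; rewrite !psiE// 1?eq_sym// angleC.
by rewrite -(opprB x xs2) -(opprB xs1 x) /angle dotpNl dotpNr opprK !enormN.
Qed.

Lemma angle_domainE (xs1 xs2 : 'rV[R]_n) (sigma1 sigma2 L : R) :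
  0 < sigma1 -> 0 < sigma2 -> 0 < L ->
  forall x, angle_domain xs1 xs2 sigma1 sigma2 L x <->
  [/\ x != xs1, x != xs2, enorm (x - xs1) <= L / sigma1
    & enorm (x - xs2) <= L / sigma2].
Proof.
move=> s1 s2 L0 x; rewrite /angle_domain !closure_eball ?divr_gt0//=; split.
  by move=> [[? ?]] /not_orP[/eqP ? /eqP ?]; split.
by move=> [/eqP ? /eqP ? ? ?]; split=> //; case.
Qed.

Lemma tphi_itv sigma (L : R) c x : 0 < sigma -> 0 < L -> enorm (x - c) <= L / sigma ->
  -1 <= sigma / L * enorm (x - c) <= 1.
Proof.
move=> s0 L0 xc; have k0 : 0 < sigma / L by rewrite divr_gt0.
apply/andP; split.
  by apply: (@le_trans _ _ 0); rewrite ?lerN10// mulr_ge0 ?enorm_ge0 ?(ltW k0).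
by rewrite -ler_pdivlMl// invf_div mulr1.
Qed.

(** Dividing the hypothesis on [g] by [enorm g * enorm (x - c)] bounds the
    cosine of the angle from below by [sigma / L * enorm (x - c)]. *)
Lemma angle_le_tphi sigma (L : R) c x g : 0 < sigma -> 0 < L -> x != c ->
  enorm g <= L -> sigma * dotp (x - c) (x - c) <= dotp g (x - c) ->
  [/\ g != 0, enorm (x - c) <= L / sigma & angle (x - c) g <= tphi L c sigma x].
Proof.
move=> s0 L0; rewrite -subr_eq0; rewrite /tphi; move: (x - c) => u u0 gL gu.
have nu : 0 < enorm u by rewrite enorm_gt0.
have gu_gt0 : 0 < dotp g u by rewrite (lt_le_trans _ gu)// mulr_gt0// dotp_gt0.
have g0 : g != 0.
  by apply: contraTneq gu_gt0 => ->; rewrite -(scale0r u) dotpZl mul0r ltxx.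
have ng : 0 < enorm g by rewrite enorm_gt0.
have sg : sigma * enorm u <= enorm g.
  rewrite -(ler_pM2r nu) -mulrA -expr2 enorm_sqr (le_trans gu)//; exact: dotp_le.
have uL : enorm u <= L / sigma.
  by rewrite ler_pdivlMr// mulrC (le_trans sg).
split => //; rewrite le_acos ?cosine_itv//; last first.
  by have := @tphi_itv sigma L 0 u s0 L0; rewrite subr0; apply.
rewrite ler_pdivlMr ?mulr_gt0// mulrA.
have -> : sigma / L * enorm u * enorm u = (sigma * dotp u u) / L.
  by rewrite -enorm_sqr; field; rewrite gt_eqF.
rewrite dotpC -ler_pdivlMr// ler_pM// ?mulr_ge0 ?dotp_ge0 ?(ltW s0) ?invr_ge0 ?(ltW L0)//.
by rewrite lef_pV2.
Qed.

(** Turn [u] by the angle [s] towards [w].  Antipodal directions are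
    excluded because they do not determine a plane in which to turn. *)
Lemma interpolate_direction u w s t : u != 0 -> w != 0 ->
  0 <= s -> 0 <= t -> s + t = angle u w -> angle u w < pi ->
  exists h, [/\ dotp h h = 1, dotp h u = cos s * enorm u
              & dotp h w = cos t * enorm w].
Proof.
move=> u0 w0 s0 t0 st st_pi.
have uE : u = enorm u *: direction u.
  by rewrite scalerA divff ?scale1r// gt_eqF ?enorm_gt0.
have wE : w = enorm w *: direction w.
  by rewrite scalerA divff ?scale1r// gt_eqF ?enorm_gt0.
have uu := direction_sqr u0; have ww := direction_sqr w0.
have cE : dotp (direction u) (direction w) = cos (s + t).
  by rewrite dotp_direction st cos_angle.
suff [h [hh hu hw]] : exists h, [/\ dotp h h = 1, dotp h (direction u) = cos s
    & dotp h (direction w) = cos t].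
  exists h; split => //.
    by rewrite {1}uE dotpZr hu mulrC.
  by rewrite {1}wE dotpZr hw mulrC.
move: (direction u) (direction w) uu ww cE => {uE wE} p q pp qq pq.
have [st0|st0] := eqVneq (s + t) 0.
  have [-> ->] : s = 0 /\ t = 0 by split; lra.
  by exists p; rewrite pp pq st0 cos0.
have sin0 : 0 < sin (s + t).
  by rewrite sin_gt0_pi// st st_pi andbT -st lt0r st0 addr_ge0.
(* The bracket is the component of q orthogonal to p, of norm sin (s + t). *)
exists (cos s *: p + (sin s / sin (s + t)) *: (q - cos (s + t) *: p)).
have sc := cos2Dsin2 (s + t); have ss := cos2Dsin2 s.
rewrite !dotpE (dotpC q p) pp qq pq; split.
- transitivity (cos s ^+ 2 + sin s ^+ 2 / sin (s + t) ^+ 2 * (1 - cos (s + t) ^+ 2)).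
    by field; rewrite gt_eqF.
  have -> : 1 - cos (s + t) ^+ 2 = sin (s + t) ^+ 2 by rewrite -sc; ring.
  by rewrite divfK ?expf_neq0 ?gt_eqF.
- by ring.
- have -> : cos t = cos ((s + t) - s) by rewrite addrAC subrr add0r.
  rewrite cosB.
  transitivity (cos s * cos (s + t) + sin s / sin (s + t) * (1 - cos (s + t) ^+ 2)).
    by field; rewrite gt_eqF.
  have -> : 1 - cos (s + t) ^+ 2 = sin (s + t) ^+ 2 by rewrite -sc; ring.
  by field; rewrite gt_eqF.
Qed.

(** A vector of length [L] at the extreme angle [tphi] from [x - c] has
    exactly the product [sigma * dotp (x - c) (x - c)] with it, so it must be
    [sigma *: (x - c)] itself.  That is the case when [tphi] vanishes, because
    then [enorm (x - c) = L / sigma]. *)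
Lemma steep_direction sigma (L : R) c x h s : 0 < sigma -> 0 < L -> x != c ->
  enorm (x - c) <= L / sigma -> dotp h h = 1 -> 0 <= s ->
  dotp h (x - c) = cos s * enorm (x - c) ->
  s < tphi L c sigma x \/ s = 0 /\ tphi L c sigma x = 0 ->
  L *: h = sigma *: (x - c)
  \/ sigma * dotp (x - c) (x - c) < dotp (L *: h) (x - c).
Proof.
move=> s0 L0 xc xL hh t0 hx.
have nx : 0 < enorm (x - c) by rewrite enorm_gt0 subr_eq0.
have kE := tphi_itv s0 L0 xL.
have cosE : cos (tphi L c sigma x) = sigma / L * enorm (x - c).
  by rewrite acosK// in_itv.
case=> [st|[se te]]; [right|left].
  have : cos (tphi L c sigma x) < cos s.
    rewrite ltr_cos// in_itv/= ?acos_ge0 ?acos_lepi// t0/=.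
    by rewrite (le_trans (ltW st))// acos_lepi.
  rewrite cosE mulrAC ltr_pdivrMr// => sc.
  rewrite dotpZl hx -enorm_sqr expr2 mulrA mulrA ltr_pM2r//.
  by rewrite [ltRHS]mulrC.
move: cosE; rewrite te cos0 => /esym e1.
move: hx; rewrite se cos0 mul1r => hx.
have LE : L = sigma * enorm (x - c).
  by rewrite -[LHS]mulr1 -e1; field; rewrite gt_eqF.
move: hx LE; have := enorm_sqr (x - c); move: (x - c) (enorm _) => u d ud hu LE.
apply/eqP; rewrite -subr_eq0 -dotp_eq0 !dotpE (dotpC u h) hh hu -ud LE.
by apply/eqP; ring.
Qed.

End Regions.

(** * Inner approximation, solution region, outer approximation *)

Section Inclusions.
Context {R : realType} {n : nat}.
Variables (xs1 xs2 : 'rV[R]_n) (sigma1 sigma2 L : R).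
Hypotheses (x12 : xs1 != xs2) (sigma1_gt0 : 0 < sigma1)
  (sigma2_gt0 : 0 < sigma2) (L_gt0 : 0 < L).

(** The gradient [g] of [f1] makes an angle at most [tphi] with [x - xs1],
    and [- g] one with [x - xs2]; the angle triangle inequality through [g]
    bounds [psi]. *)
Lemma solution_region_outer :
  solution_region xs1 xs2 sigma1 sigma2 L `<=` outer_approx xs1 xs2 sigma1 sigma2 L.
Proof.
move=> x [f1 [f2 [S1 S2 g12 _ g2L]]].
have h1 := sc_class_gradient_necessary x S1.
have h2 := sc_class_gradient_necessary x S2.
have g1L : enorm (gradient f1 x) <= L by rewrite g12 enormN.
have center (c : 'rV[R]_n) sigma : 0 < sigma ->
    sigma * dotp (x - c) (x - c) <= 0 -> x = c.
  move=> s0; rewrite pmulr_rle0// => xc0; apply/eqP.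
  by rewrite -subr_eq0 -dotp_eq0 eq_le xc0 dotp_ge0.
have x1 : x != xs1.
  apply/eqP => xE; move: x12; rewrite -xE (center xs2 sigma2) ?eqxx//.
  rewrite (le_trans h2)// -[gradient f2 x]opprK -g12 xE (gradient_center S1) oppr0.
  by rewrite -(scale0r 0) dotpZl mul0r.
have x2 : x != xs2.
  apply/eqP => xE; move: x12; rewrite -xE (center xs1 sigma1) ?eqxx//.
  rewrite (le_trans h1)// g12 xE (gradient_center S2) oppr0.
  by rewrite -(scale0r 0) dotpZl mul0r.
have [g1 d1 a1] := angle_le_tphi sigma1_gt0 L_gt0 x1 g1L h1.
have [g2 d2 a2] := angle_le_tphi sigma2_gt0 L_gt0 x2 g2L h2.
split; first exact/angle_domainE.
rewrite psiE//; apply: le_trans (lerD a1 a2).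
have <- : angle (gradient f1 x) (xs2 - x) = angle (x - xs2) (gradient f2 x).
  by rewrite g12 angleC /angle -[xs2 - x]opprB !(dotpNl, dotpNr) opprK !enormN.
by apply: angle_triangle; rewrite ?subr_eq0// eq_sym.
Qed.

Lemma solution_region_gradient (x g : 'rV[R]_n) : enorm g <= L ->
  g = sigma1 *: (x - xs1) \/ sigma1 * dotp (x - xs1) (x - xs1) < dotp g (x - xs1) ->
  - g = sigma2 *: (x - xs2) \/ sigma2 * dotp (x - xs2) (x - xs2) < dotp (- g) (x - xs2) ->
  solution_region xs1 xs2 sigma1 sigma2 L x.
Proof.
move=> gL h1 h2.
have [f1 S1 g1] := sc_class_gradient_sufficient (ltW sigma1_gt0) h1.
have [f2 S2 g2] := sc_class_gradient_sufficient (ltW sigma2_gt0) h2.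
by exists f1, f2; split; rewrite // ?g1 ?g2 ?opprK ?enormN.
Qed.

(** At a point of tangency the extreme gradients
    [sigma1 *: (x - xs1)] and [sigma2 *: (x - xs2)] are opposite. *)
Lemma tangency_solution_region :
  tangency_set xs1 xs2 sigma1 sigma2 L `<=` solution_region xs1 xs2 sigma1 sigma2 L.
Proof.
move=> x; rewrite /tangency_set; case: ifPn => //= /eqP dE [d1 d2].
apply: (@solution_region_gradient x (sigma1 *: (x - xs1))).
- by rewrite enormZ gtr0_norm// d1 mulrC divfK// gt_eqF.
- by left.
- left; apply/eqP; rewrite eq_sym -subr_eq0 opprK -dotp_eq0.
  have E : (x - xs1) - (x - xs2) = xs2 - xs1 by rewrite opprB [LHS]addrC subrKA.
  have := enorm_sqr (xs2 - xs1); rewrite dE -E.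
  have := enorm_sqr (x - xs1); rewrite d1; have := enorm_sqr (x - xs2); rewrite d2.
  move: (x - xs1) (x - xs2) => u v v2 u2; rewrite !dotpE (dotpC v u) -u2 -v2 => uv.
  have {uv} -> : dotp u v = - (L ^+ 2 / (sigma1 * sigma2)).
    apply: (@mulIf _ 2); first by rewrite pnatr_eq0.
    transitivity ((L / sigma1) ^+ 2 + (L / sigma2) ^+ 2
        - (L * (sigma1^-1 + sigma2^-1)) ^+ 2).
      by rewrite uv; ring.
    by field; rewrite !gt_eqF.
  by apply/eqP; field; rewrite !gt_eqF.
Qed.

(** Split [psi] between the two centers in the proportion of the two
    [tphi].  Each share is then strictly below its [tphi], unless both
    vanish, which is the alternative that [steep_direction] allows. *)
Lemma inner_solution_region :
  inner_approx xs1 xs2 sigma1 sigma2 L `<=` solution_region xs1 xs2 sigma1 sigma2 L.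
Proof.
move=> x [[]|]; last exact: tangency_solution_region.
move=> /angle_domainE[]// x1 x2 d1 d2.
rewrite psiE// => lt_psi.
set ps := angle _ _ in lt_psi; set a := tphi _ _ _ _ in lt_psi.
set b := tphi _ _ _ _ in lt_psi.
have i1 := tphi_itv sigma1_gt0 L_gt0 d1.
have i2 := tphi_itv sigma2_gt0 L_gt0 d2.
have a0 : 0 <= a by rewrite acos_ge0.
have b0 : 0 <= b by rewrite acos_ge0.
have half (sigma : R) c : 0 < sigma -> enorm (x - c) <= L / sigma ->
    tphi L c sigma x <= pi / 2.
  move=> s0 dc; have k0 : 0 < sigma / L by rewrite divr_gt0.
  rewrite -acos0 le_acos ?tphi_itv ?lerN10 ?ler01//.
  by rewrite mulr_ge0 ?enorm_ge0 ?(ltW k0).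
have ab_pi : a + b <= pi.
  by rewrite [leRHS]splitr lerD// half.
have ps0 : 0 <= ps := angle_ge0 _ _.
have ab0 : 0 < a + b := le_lt_trans ps0 lt_psi.
pose k := ps / (a + b).
have k0 : 0 <= k by rewrite divr_ge0// ltW.
have k1 : k < 1 by rewrite ltr_pdivrMr// mul1r.
have shrink t : 0 <= t -> k * t < t \/ k * t = 0 /\ t = 0.
  rewrite le_eqVlt => /predU1P[<-|t0]; [right|left]; first by rewrite mulr0.
  by rewrite gtr_pMl.
have [h [hh h1 h2]] : exists h, [/\ dotp h h = 1,
    dotp h (x - xs1) = cos (k * a) * enorm (x - xs1)
  & dotp h (xs2 - x) = cos (k * b) * enorm (xs2 - x)].
  apply: interpolate_direction; rewrite ?subr_eq0 1?[xs2 == _]eq_sym ?(mulr_ge0 k0)//.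
    by rewrite -mulrDr divfK// gt_eqF.
  exact: lt_le_trans lt_psi ab_pi.
apply: (@solution_region_gradient x (L *: h)).
- by rewrite enormZ gtr0_norm// /enorm hh sqrtr1 mulr1.
- apply: steep_direction h1 _ => //; first exact: mulr_ge0.
  exact: shrink.
rewrite -scalerN; apply: (@steep_direction _ _ _ _ _ _ _ (k * b)) => //.
- by rewrite dotpNl dotpNr opprK.
- exact: mulr_ge0.
- by rewrite dotpNl -dotpNr opprB h2 enormB.
- exact: shrink.
Qed.

End Inclusions.

(** * Perturbation of critical points by rotation *)

Section Rotation.
Context {R : realType} {n : nat}.
Implicit Types (x y : 'rV[R]_n) (s t sigma : R).

(** The law of cosines.  It makes the cosine of [psi] a function of the
    distances to the two centers. *)
Lemma sqr_dist (x xs1 xs2 : 'rV[R]_n) :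
  enorm (xs2 - xs1) ^+ 2 = enorm (x - xs1) ^+ 2 + enorm (x - xs2) ^+ 2
    + dotp (x - xs1) (xs2 - x) *+ 2.
Proof.
have -> : xs2 - xs1 = (x - xs1) - (x - xs2) by rewrite opprB [RHS]addrC subrKA.
rewrite -(opprB x xs2) !enorm_sqr; move: (x - xs1) (x - xs2) => u v.
by rewrite !dotpE (dotpC v u); ring.
Qed.

(** By the law of cosines, with [p = enorm (x - xs1)] fixed, the cosine of
    [psi] is [((D^2 - p^2) / m - m) / (2 p)] at distance [m] from [xs2].  Its
    difference between the distances [m <= q] is proportional to
    [(q - m) (D^2 - p^2 + m q)]. *)
Lemma psi_le (xs1 xs2 x y : 'rV[R]_n) : xs1 != xs2 -> x != xs1 -> x != xs2 ->
  y != xs2 -> enorm (y - xs1) = enorm (x - xs1) ->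
  enorm (y - xs2) <= enorm (x - xs2) ->
  enorm (x - xs1) ^+ 2 - enorm (xs2 - xs1) ^+ 2
    <= enorm (y - xs2) * enorm (x - xs2) ->
  psi xs1 xs2 y <= psi xs1 xs2 x.
Proof.
move=> x12 x1 x2 y2 yx1 yx2 K.
have nx1 : 0 < enorm (x - xs1) by rewrite enorm_gt0 subr_eq0.
have nx2 : 0 < enorm (x - xs2) by rewrite enorm_gt0 subr_eq0.
have ny2 : 0 < enorm (y - xs2) by rewrite enorm_gt0 subr_eq0.
have y1 : y != xs1 by rewrite -subr_eq0 -enorm_gt0 yx1.
rewrite !psiE// le_acos ?cosine_itv// yx1 (enormB xs2 x) (enormB xs2 y).
have := sqr_dist x xs1 xs2; have := sqr_dist y xs1 xs2; rewrite yx1.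
move: K nx1 nx2 ny2 yx2.
move: (dotp (y - xs1) _) (dotp (x - xs1) _) => a b.
move: (enorm (x - xs1)) (enorm (x - xs2)) (enorm (y - xs2)) (enorm (xs2 - xs1) ^+ 2).
move=> p q m D2 K p0 q0 m0 mq ea eb.
rewrite ler_pdivrMr ?mulr_gt0// mulrAC ler_pdivlMr ?mulr_gt0// -subr_ge0.
have -> : a = (D2 - p ^+ 2 - m ^+ 2) / 2 by rewrite ea; field.
have -> : b = (D2 - p ^+ 2 - q ^+ 2) / 2 by rewrite eb; field.
rewrite [leRHS](_ : _ = p * ((q - m) * (m * q - (p ^+ 2 - D2)) / 2)); last by field.
by rewrite mulr_ge0 ?(ltW p0)// divr_ge0// mulr_ge0// subr_ge0.
Qed.

(** The circle about [xs1] through [x], in the plane spanned by [x], [xs1]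
    and [xs2].  It is parametrized by the decrease [t] of the squared distance
    to [xs2], which is affine in the coordinate along [xs2 - xs1]. *)
Lemma rotation_path (xs1 xs2 x : 'rV[R]_n) : xs1 != xs2 ->
  `|dotp (x - xs1) (xs2 - x)| < enorm (x - xs1) * enorm (xs2 - x) ->
  exists g : R -> 'rV[R]_n, [/\ g 0 = x, continuous g &
    \forall t \near 0, enorm (g t - xs1) = enorm (x - xs1) /\
      enorm (g t - xs2) ^+ 2 = enorm (x - xs2) ^+ 2 - t].
Proof.
move=> x12 gram.
move yE : (x - xs1) => y; move eE : (xs2 - xs1) => e.
have x2E : xs2 - x = e - y by rewrite -eE -yE opprB subrKA.
have e0 : 0 < dotp e e by rewrite dotp_gt0 -eE subr_eq0 eq_sym.
set P := dotp y e.
have S0 : 0 < dotp y y * dotp e e - P ^+ 2.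
  move: gram; rewrite x2E yE -(@ltr_pXn2r _ 2)// ?nnegrE ?mulr_ge0 ?enorm_ge0//.
  rewrite real_normK ?num_real// exprMn !enorm_sqr !dotpE -/P (dotpC e y) -/P.
  by lra.
move vE : (y - (P / dotp e e) *: e) => v.
have ve : dotp v e = 0 by rewrite -vE dotpBl dotpZl -/P divfK ?subrr// gt_eqF.
have vvE : dotp v v = (dotp y y * dotp e e - P ^+ 2) / dotp e e.
  rewrite -{2}vE dotpBr dotpZr ve mulr0 subr0 -vE dotpBl dotpZl (dotpC e y) -/P.
  by field; rewrite gt_eqF.
have vv0 : 0 < dotp v v by rewrite vvE divr_gt0.
(* A t and sqrt (N t) are the coordinates along e and v.  Moving by A t along e
   lowers the squared distance to xs2 by t; N t keeps the one to xs1 constant. *)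
pose A t := (P + t / 2) / dotp e e.
pose N t := (dotp y y - A t ^+ 2 * dotp e e) / dotp v v.
pose g t := xs1 + (A t *: e + Num.sqrt (N t) *: v).
have A0 : A 0 = P / dotp e e by rewrite /A mul0r addr0.
have N0 : N 0 = 1.
  rewrite /N A0 vvE; field; rewrite !gt_eqF//; lra.
have cA : continuous A.
  move=> t; apply: cvgMr_tmp; apply: cvgD; first exact: cvg_cst.
  apply: cvgMr_tmp; exact: cvg_id.
have cN : continuous N.
  move=> t; apply: cvgMr_tmp; apply: cvgB; first exact: cvg_cst.
  apply: cvgMr_tmp; rewrite /GRing.exp/=; apply: cvgM; exact: cA.
exists g; split.
- by rewrite /g A0 N0 sqrtr1 scale1r -vE subrKC -yE subrKC.
- move=> t; apply: cvgD; first exact: cvg_cst.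
  apply: cvgD; first by apply: cvgZr_tmp; exact: cA.
  apply: cvgZr_tmp; apply: (@continuous_comp _ _ _ N Num.sqrt); first exact: cN.
  exact: sqrt_continuous.
have N0_gt0 : 0 < N 0 by rewrite N0.
have N_gt0 : \forall t \near (0 : R), 0 < N t.
  by apply: (cvgr_gt (N 0) (cN 0)); exact: N0_gt0.
apply: filterS N_gt0 => t Nt.
have gy : g t - xs1 = A t *: e + Num.sqrt (N t) *: v by rewrite /g addrC addKr.
have d1 : dotp (g t - xs1) (g t - xs1) = dotp y y.
  rewrite gy !dotpE ve (dotpC e v) ve.
  transitivity (A t ^+ 2 * dotp e e + Num.sqrt (N t) ^+ 2 * dotp v v); first by ring.
  by rewrite sqr_sqrtr ?(ltW Nt)// divfK ?gt_eqF// addrC subrK.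
split; first by rewrite /enorm d1.
have ge : dotp (g t - xs1) e = P + t / 2.
  by rewrite gy dotpDl !dotpZl ve mulr0 addr0 divfK// gt_eqF.
have E u : u - xs2 = (u - xs1) - e by rewrite -eE opprB subrKA.
rewrite !enorm_sqr (E x) (E (g t)) yE.
move: d1 ge; move: (g t - xs1) => u d1 ge.
by rewrite !dotpE (dotpC e u) (dotpC e y) ge d1 -/P; field.
Qed.

Lemma near_path (g : R -> 'rV[R]_n) (B : set 'rV[R]_n) (Q : R -> Prop) :
  continuous g -> nbhs (g 0) B -> (\forall t \near 0, Q t) ->
  exists2 t, 0 < t & [/\ B (g t), Q t, B (g (- t)) & Q (- t)].
Proof.
move=> cg Bx Qt.
have : \forall t \near 0, B (g t) /\ Q t.
  by apply: filterI => //; exact: (cg 0 B Bx).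
move=> /nbhs_ballP[e /= e0 he].
exists (e / 2); first by rewrite divr_gt0.
have e2 : 0 < e / 2 by rewrite divr_gt0.
have [] : B (g (e / 2)) /\ Q (e / 2).
  by apply: he; rewrite /ball/= sub0r normrN gtr0_norm//; lra.
have [] : B (g (- (e / 2))) /\ Q (- (e / 2)).
  by apply: he; rewrite /ball/= sub0r opprK gtr0_norm//; lra.
by split.
Qed.

(** If [x] is on the line through the centers, [psi] is [pi] or [0].
    The former exceeds the sum of the [tphi], which are both below [pi / 2];
    the latter forces both [tphi] to vanish, and the balls are tangent at [x]. *)
Lemma critical_not_aligned (xs1 xs2 x : 'rV[R]_n) (sigma1 sigma2 L : R) :
  xs1 != xs2 -> 0 < sigma1 -> 0 < sigma2 -> 0 < L ->
  angle_domain xs1 xs2 sigma1 sigma2 L x ->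
  ~ tangency_set xs1 xs2 sigma1 sigma2 L x ->
  tphi L xs1 sigma1 x + tphi L xs2 sigma2 x = psi xs1 xs2 x ->
  `|dotp (x - xs1) (xs2 - x)| < enorm (x - xs1) * enorm (xs2 - x).
Proof.
move=> x12 s1 s2 L0 /(angle_domainE _ _ s1 s2 L0)[x1 x2 d1 d2] tan0 F0.
have i1 := tphi_itv s1 L0 d1; have i2 := tphi_itv s2 L0 d2.
have nx1 : 0 < enorm (x - xs1) by rewrite enorm_gt0 subr_eq0.
have nx2 : 0 < enorm (x - xs2) by rewrite enorm_gt0 subr_eq0.
rewrite lt_neqAle dotp_le_enorm andbT; apply/negP => /eqP.
have [dge0|dlt0] := ger0P (dotp _ _); rewrite (enormB xs2) => dE; last first.
  have : psi xs1 xs2 x = pi.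
    rewrite psiE// /angle (enormB xs2) -dE invrN mulrN divff ?lt_eqF//.
    exact: acosN1.
  have lt_half sigma c : 0 < sigma -> -1 <= sigma / L * enorm (x - c) <= 1 ->
     0 < enorm (x - c) -> tphi L c sigma x < pi / 2.
    move=> s0 ic nc; rewrite -acos0 lt_acos ?lerN10 ?ler01//.
    by rewrite mulr_gt0// divr_gt0.
  have := lt_half _ _ s1 i1 nx1; have := lt_half _ _ s2 i2 nx2.
  rewrite -F0 [X in _ = X]splitr => h1 h2 h3; lra.
have psi0 : psi xs1 xs2 x = 0.
  rewrite psiE// /angle (enormB xs2) -dE divff ?acos1// dE.
  by rewrite gt_eqF// mulr_gt0.
have tight sigma c : 0 < sigma -> -1 <= sigma / L * enorm (x - c) <= 1 ->
    tphi L c sigma x = 0 -> enorm (x - c) = L / sigma.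
  move=> s0 ic h; have : cos (tphi L c sigma x) = sigma / L * enorm (x - c).
    by rewrite acosK// in_itv.
  rewrite h cos0 => /(congr1 ( *%R (L / sigma))); rewrite mulr1 => ->.
  by field; rewrite !gt_eqF.
have a0 : 0 <= tphi L xs1 sigma1 x by rewrite acos_ge0.
have b0 : 0 <= tphi L xs2 sigma2 x by rewrite acos_ge0.
have t1 : enorm (x - xs1) = L / sigma1 by apply: tight => //; lra.
have t2 : enorm (x - xs2) = L / sigma2 by apply: tight => //; lra.
apply: tan0; rewrite /tangency_set ifT//.
apply/eqP/eqP; rewrite -(@eqrXn2 _ 2)// ?enorm_ge0//; last first.
  by rewrite mulr_ge0 ?(ltW L0)// addr_ge0// invr_ge0 ltW.
rewrite (sqr_dist x) dE t1 t2; apply/eqP; ring.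
Qed.

(** The angle of the triangle at [xs2] being acute makes [psi] monotone
    along the rotation of [x] about [xs1]. *)
Lemma perturb_acute (xs1 xs2 x : 'rV[R]_n) (sigma1 sigma2 L : R) (B : set 'rV[R]_n) :
  xs1 != xs2 -> 0 < sigma1 -> 0 < sigma2 -> 0 < L ->
  angle_domain xs1 xs2 sigma1 sigma2 L x ->
  ~ tangency_set xs1 xs2 sigma1 sigma2 L x ->
  tphi L xs1 sigma1 x + tphi L xs2 sigma2 x = psi xs1 xs2 x ->
  enorm (x - xs1) ^+ 2 < enorm (x - xs2) ^+ 2 + enorm (xs2 - xs1) ^+ 2 ->
  nbhs x B ->
  (exists2 y, B y & inner_approx xs1 xs2 sigma1 sigma2 L y)
  /\ (exists2 y, B y & ~ outer_approx xs1 xs2 sigma1 sigma2 L y).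
Proof.
move=> x12 s1 s2 L0 Dx tan0 F0 acute Bx.
have gram := critical_not_aligned x12 s1 s2 L0 Dx tan0 F0.
have [g [g0 cg gE]] := rotation_path x12 gram.
have /(angle_domainE _ _ s1 s2 L0)[x1 x2 d1 d2] := Dx.
have nx1 : 0 < enorm (x - xs1) by rewrite enorm_gt0 subr_eq0.
have nx2 : 0 < enorm (x - xs2) by rewrite enorm_gt0 subr_eq0.
have near0 : \forall t \near 0, [/\ enorm (g t - xs1) = enorm (x - xs1),
   enorm (g t - xs2) ^+ 2 = enorm (x - xs2) ^+ 2 - t,
   g t != xs2 &
   enorm (x - xs1) ^+ 2 - enorm (xs2 - xs1) ^+ 2
     <= enorm (g t - xs2) * enorm (x - xs2)].
  set a := enorm (x - xs1) ^+ 2 - enorm (xs2 - xs1) ^+ 2.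
  (* Both squared distances to xs2 exceed b near t = 0, hence so does the
     product of the distances. *)
  pose b := Num.max 0 a.
  have : \forall t \near (0 : R), b < enorm (x - xs2) ^+ 2 - t.
    have cb : continuous (fun t : R => enorm (x - xs2) ^+ 2 - t).
      move=> t; apply: (@continuousB _ _ _ (cst _) id); last exact: cvg_id.
      exact: cst_continuous.
    apply: (cvgr_gt _ (cb 0)).
    rewrite subr0 gt_max exprn_gt0//= /a; lra.
  apply: filterS2 gE => t [e1 e2]; rewrite -e2 gt_max => /andP[m0 ma].
  have nm : 0 < enorm (g t - xs2).
    by rewrite lt0r enorm_ge0 andbT; apply: contraTneq m0 => ->; rewrite expr0n ltxx.
  split => //; first by rewrite -subr_eq0 -enorm_gt0.
  have [a0|a0] := lerP a 0; first by rewrite (le_trans a0)// mulr_ge0 ?enorm_ge0.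
  rewrite -(@ler_pXn2r _ 2)// ?nnegrE ?mulr_ge0 ?enorm_ge0 ?(ltW a0)//.
  rewrite exprMn expr2 ler_pM ?(ltW a0) ?(ltW ma)//; rewrite /a; lra.
have Bg0 : nbhs (g 0) B by rewrite g0.
have [t t0 [Bt [e1 e2 g2 K] BNt [f1 f2 h2 KN]]] := near_path cg Bg0 near0.
split.
- have lt2 : enorm (g t - xs2) < enorm (x - xs2).
    by rewrite -(@ltr_pXn2r _ 2)// ?nnegrE ?enorm_ge0// e2; lra.
  have dg1 : enorm (g t - xs1) <= L / sigma1 by rewrite e1.
  have dg2 : enorm (g t - xs2) <= L / sigma2 by rewrite (le_trans (ltW lt2)).
  have psi_gt : psi xs1 xs2 (g t) <= psi xs1 xs2 x by apply: psi_le => //; exact: ltW.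
  exists (g t) => //; left; split.
    by apply/angle_domainE => //; split=> //; rewrite -subr_eq0 -enorm_gt0 e1.
  rewrite (le_lt_trans psi_gt)// -F0 /tphi e1 ltrD2l lt_acos ?tphi_itv//.
  by rewrite ltr_pM2l// divr_gt0.
- exists (g (- t)) => //; case=> /(angle_domainE _ _ s1 s2 L0)[g1 _ dg1 dg2].
  have lt2 : enorm (x - xs2) < enorm (g (- t) - xs2).
    by rewrite -(@ltr_pXn2r _ 2)// ?nnegrE ?enorm_ge0// f2; lra.
  have psi_gt : psi xs1 xs2 x <= psi xs1 xs2 (g (- t)).
    by apply: psi_le => //; [exact: ltW|rewrite f1 mulrC].
  apply/negP; rewrite -ltNge (lt_le_trans _ psi_gt)// -F0 /tphi f1 ltrD2l.
  by rewrite lt_acos ?tphi_itv// ltr_pM2l// divr_gt0.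
Qed.

End Rotation.

(** * Boundaries *)

Section Swap.
Context {R : realType} {n : nat}.
Variables (xs1 xs2 : 'rV[R]_n) (sigma1 sigma2 L : R).
Hypotheses (x12 : xs1 != xs2) (sigma1_gt0 : 0 < sigma1)
  (sigma2_gt0 : 0 < sigma2) (L_gt0 : 0 < L).

Lemma tangency_setC : tangency_set xs1 xs2 sigma1 sigma2 L
  = tangency_set xs2 xs1 sigma2 sigma1 L.
Proof.
rewrite /tangency_set enormB [sigma1^-1 + _]addrC; case: ifP => // _.
by apply/seteqP; split=> x /= [].
Qed.

Lemma angle_domainC : angle_domain xs1 xs2 sigma1 sigma2 L
  = angle_domain xs2 xs1 sigma2 sigma1 L.
Proof. by rewrite /angle_domain setIC [X in _ `\` X]setUC. Qed.

Lemma angle_domain_neq x : angle_domain xs1 xs2 sigma1 sigma2 L x ->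
  x != xs1 /\ x != xs2.
Proof. by case=> _ /not_orP[/eqP ? /eqP ?]. Qed.

Lemma outer_approxC : outer_approx xs1 xs2 sigma1 sigma2 L
  = outer_approx xs2 xs1 sigma2 sigma1 L.
Proof.
rewrite /outer_approx -angle_domainC; apply/seteqP; split=> x /= [Dx];
  have [x1 x2] := angle_domain_neq Dx;
  by rewrite (psiC x12 x1 x2) (addrC (tphi L xs1 sigma1 x)).
Qed.

Lemma inner_approxC : inner_approx xs1 xs2 sigma1 sigma2 L
  = inner_approx xs2 xs1 sigma2 sigma1 L.
Proof.
rewrite /inner_approx -angle_domainC tangency_setC; congr (_ `|` _).
apply/seteqP; split=> x /= [Dx];
  have [x1 x2] := angle_domain_neq Dx;
  by rewrite (psiC x12 x1 x2) (addrC (tphi L xs1 sigma1 x)).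
Qed.

End Swap.

Section Boundaries.
Context {R : realType} {n : nat}.

(** Of two angles of a triangle at least one is acute; exchanging the
    centers if necessary, it is the one at [xs2]. *)
Lemma perturb_critical (xs1 xs2 x : 'rV[R]_n) (sigma1 sigma2 L : R) B :
  xs1 != xs2 -> 0 < sigma1 -> 0 < sigma2 -> 0 < L ->
  angle_domain xs1 xs2 sigma1 sigma2 L x ->
  ~ tangency_set xs1 xs2 sigma1 sigma2 L x ->
  tphi L xs1 sigma1 x + tphi L xs2 sigma2 x = psi xs1 xs2 x ->
  nbhs x B ->
  (exists2 y, B y & inner_approx xs1 xs2 sigma1 sigma2 L y)
  /\ (exists2 y, B y & ~ outer_approx xs1 xs2 sigma1 sigma2 L y).
Proof.
move=> x12 s1 s2 L0 Dx tan0 F0 Bx.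
have [obtuse|acute] := lerP (enorm (x - xs2) ^+ 2 + enorm (xs2 - xs1) ^+ 2)
    (enorm (x - xs1) ^+ 2); last exact: (perturb_acute x12 s1 s2 L0 Dx tan0 F0 acute Bx).
have [x1 x2] := angle_domain_neq Dx.
rewrite inner_approxC// outer_approxC//; apply: perturb_acute Bx => //.
- by rewrite eq_sym.
- by rewrite -angle_domainC.
- by rewrite -tangency_setC.
- by rewrite addrC F0 psiC.
rewrite (enormB xs1); have : 0 < enorm (xs2 - xs1) ^+ 2.
  by rewrite exprn_gt0// enorm_gt0 subr_eq0 eq_sym.
lra.
Qed.

Lemma boundary_sandwich (A B : set 'rV[R]_n) :
  A `<=` B -> B `<=` closure A -> interior B `<=` A -> boundary B = boundary A.
Proof.
move=> AB BA iBA; rewrite /boundary; congr (_ `\` _); apply/seteqP; split.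
- by rewrite [X in _ `<=` X](closure_id _).1; [exact: closureS|exact: closed_closure].
- exact: closureS.
- by rewrite -open_subsetE//; exact: open_interior.
- exact: interiorS.
Qed.

Section Approximations.
Variables (xs1 xs2 : 'rV[R]_n) (sigma1 sigma2 L : R).
Hypotheses (x12 : xs1 != xs2) (sigma1_gt0 : 0 < sigma1)
  (sigma2_gt0 : 0 < sigma2) (L_gt0 : 0 < L).

Lemma outer_approx_closure :
  outer_approx xs1 xs2 sigma1 sigma2 L
    `<=` closure (inner_approx xs1 xs2 sigma1 sigma2 L).
Proof.
move=> x [Dx]; have [tanx _|tan0] := pselect (tangency_set xs1 xs2 sigma1 sigma2 L x).
  by apply: subset_closure; right.
rewrite le_eqVlt => /predU1P[F0|?]; last by apply: subset_closure; left.
move=> B Bx; have [[y By Iy] _] :=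
  perturb_critical x12 sigma1_gt0 sigma2_gt0 L_gt0 Dx tan0 (esym F0) Bx.
by exists y.
Qed.

Lemma interior_outer_approx :
  interior (outer_approx xs1 xs2 sigma1 sigma2 L)
    `<=` inner_approx xs1 xs2 sigma1 sigma2 L.
Proof.
move=> x oB; have [Dx] := interior_subset oB.
have [tanx _|tan0] := pselect (tangency_set xs1 xs2 sigma1 sigma2 L x); first by right.
rewrite le_eqVlt => /predU1P[F0|?]; last by left.
by have [_ []] :=
  perturb_critical x12 sigma1_gt0 sigma2_gt0 L_gt0 Dx tan0 (esym F0) oB.
Qed.

Lemma boundary_regions :
  boundary (solution_region xs1 xs2 sigma1 sigma2 L)
    = boundary (outer_approx xs1 xs2 sigma1 sigma2 L)
  /\ boundary (outer_approx xs1 xs2 sigma1 sigma2 L)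
    = boundary (inner_approx xs1 xs2 sigma1 sigma2 L).
Proof.
have IM := inner_solution_region x12 sigma1_gt0 sigma2_gt0 L_gt0.
have MO := solution_region_outer x12 sigma1_gt0 sigma2_gt0 L_gt0.
have OI :=
  boundary_sandwich (subset_trans IM MO) outer_approx_closure interior_outer_approx.
split=> //; rewrite OI; apply: boundary_sandwich => //.
  exact: subset_trans MO outer_approx_closure.
exact: subset_trans (interiorS MO) interior_outer_approx.
Qed.

End Approximations.
End Boundaries.

Theorem theorem6p2 (R : realType) (n : nat) (r sigma1 sigma2 L : R)
    (n_gt0 : (0 < n)%N) (r_gt0 : 0 < r)
    (sigma1_gt0 : 0 < sigma1) (sigma2_gt0 : 0 < sigma2) (L_gt0 : 0 < L) :
  let xs1 : 'rV[R]_n := axis_point n (- r) in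
  let xs2 : 'rV[R]_n := axis_point n r in
  boundary (solution_region xs1 xs2 sigma1 sigma2 L)
    = boundary (outer_approx xs1 xs2 sigma1 sigma2 L)
  /\ boundary (outer_approx xs1 xs2 sigma1 sigma2 L)
    = boundary (inner_approx xs1 xs2 sigma1 sigma2 L).
Proof.
apply: boundary_regions => //; apply/eqP => /rowP/(_ (Ordinal n_gt0)).
by rewrite !mxE/= => rE; lra.
Qed.
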